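(* For every finite group $G$, $b_1(G)=l(G)$.
   Context: Let $G$ be a finite group. A permutation representation of $G$ is a homomorphism from $G$ to the group of permutations of a set $\Omega$ (not necessarily faithful). A base for the representation is a finite sequence of points of $\Omega$ whose pointwise stabiliser in the permutation group induced by $G$ is the identity; equivalently, the pointwise stabiliser in $G$ of the sequence is the kernel of the representation. A base is irredundant if no point of the sequence is fixed by the pointwise stabiliser of its predecessors in the sequence. The size of a base is the number of its terms. Define $b_1(G)$ to be the maximum, over all permutation representations of $G$ (not necessarily faithful), of the maximum size of an irredundant base. Define $l(G)$ to be the length of the longest chain of subgroups of $G$, where a chain $G=G_0>G_1>\cdots>G_l=1$ of subgroups (all inclusions strict) has length $l$. *)

(* Defs.v *)
From Stdlib Require Import List.
From mathcomp Require Import all_boot all_fingroup.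

Set Implicit Arguments.
Unset Strict Implicit.
Unset Printing Implicit Defensive.

Definition is_maximum (P : nat -> Prop) (n : nat) : Prop :=
  P n /\ forall m, P m -> m <= n.

Section PermutationRepresentation.

(* A permutation representation of G on a set Omega, finite or infinite, is
   given by a (right) action of G on Omega; [action G Omega] does not require
   Omega to be finite, but the library's stabilisers do, hence the
   predicates below. *)
Variables (gT : finGroupType) (G : {group gT}) (Omega : Type).
Variable to : action G Omega.

Definition pointwise_stab (s : seq Omega) (g : gT) : Prop :=
  g \in G /\ Forall (fun x => to x g = x) s.

Definition rep_ker (g : gT) : Prop :=
  g \in G /\ forall x, to x g = x.

Definition is_base (s : seq Omega) : Prop :=
  forall g, pointwise_stab s g <-> rep_ker g.

Definition irredundant (s : seq Omega) : Prop :=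
  forall s1 x s2, s = s1 ++ x :: s2 ->
    ~ (forall g, pointwise_stab s1 g -> to x g = x).

Definition is_max_irredundant_base_size (n : nat) : Prop :=
  is_maximum
    (fun m => exists s, [/\ is_base s, irredundant s & size s = m]) n.

End PermutationRepresentation.

(* [is_b1 G n] means b_1(G) = n.  As Omega ranges over all types, b_1 is given
   by its graph; the first clause includes the fact that each of the maxima
   over which b_1(G) is taken exists. *)
Definition is_b1 (gT : finGroupType) (G : {group gT}) (n : nat) : Prop :=
  (forall (Omega : Type) (to : action G Omega),
     exists2 m, is_max_irredundant_base_size to m & m <= n) /\
  (exists (Omega : Type) (to : action G Omega),
     is_max_irredundant_base_size to n).

Section SubgroupLength.

Variables (gT : finGroupType) (G : {group gT}).

(* The sequence s = [:: G_1; ...; G_l] omits G_0 = G, so its size is l. *)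
Definition subgroup_chain (s : seq {group gT}) : bool :=
  path (fun H K : {group gT} => K \proper H) G s && (last G s == 1%G).

(* The bound #|G| on the length of a chain is harmless: see the next lemmas. *)
Definition subgroup_length : nat :=
  \max_(n < #|G|.+1 | [exists t : n.-tuple {group gT}, subgroup_chain t]) n.

Lemma size_subgroup_chain s : subgroup_chain s -> size s < #|G|.
Proof.
case/andP=> + _; elim: s (G) => [|K s IHs] H /=; first by rewrite cardG_gt0.
by case/andP=> /proper_card ltKH /IHs ltsK; apply: leq_ltn_trans ltsK ltKH.
Qed.

Lemma subgroup_lengthP :
  is_maximum (fun n => exists2 s, subgroup_chain s & size s = n)
             subgroup_length.
Proof.
have max_ge s : subgroup_chain s -> size s <= subgroup_length.
  move=> sP; have lt_s : size s < #|G|.+1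
    by rewrite ltnS ltnW // size_subgroup_chain.
  apply: (@leq_bigmax_cond _ _ (fun n : 'I_ _ => n : nat) (Ordinal lt_s)).
  by apply/existsP; exists (in_tuple s).
split=> [|m [s sP <-]]; last exact: max_ge.
have [s sP] : exists s, subgroup_chain s.
  have [G1 | ntG] := eqVneq (G : {set gT}) 1%g.
    by exists [::]; rewrite /subgroup_chain /= -val_eqE /= G1.
  by exists [:: 1%G]; rewrite /subgroup_chain /= proper1G ntG eqxx.
have lt_s : size s < #|G|.+1
    by rewrite ltnS ltnW // size_subgroup_chain.
have ex_n : exists n : 'I_#|G|.+1,
    [exists t : n.-tuple {group gT}, subgroup_chain t].
  by exists (Ordinal lt_s); apply/existsP; exists (in_tuple s).
have [n0 Pn0] := ex_n.
rewrite /subgroup_length (bigmax_eq_arg n0) //.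
case: arg_maxnP => // n /existsP[t tP] _.
by exists t; rewrite ?size_tuple.
Qed.

End SubgroupLength.

(* Main.v *)
Require Import Defs.
From Stdlib Require Import Classical List.
From mathcomp Require Import all_boot all_fingroup.

(** The bridge between bases and chains is that taking successive pointwise
    stabilisers turns an irredundant sequence of points into a strictly
    decreasing sequence of subgroups of the same length
    ([irredundant_stab_path]); so no irredundant sequence, base or not, is
    longer than l(G).  Each representation therefore has an irredundant sequence
    of maximal size, which has to be a base, since otherwise a point moved by
    its stabiliser could be appended to it ([irredundant_maximal_base]).

    Conversely, let G act by right multiplication on the subsets of the ambient
    group.  The stabiliser of a subgroup H, viewed as a point, is H itself, so
    the terms below G of a chain of subgroups form an irredundant base
    ([subgroup_chain_base]), and a longest chain gives one of size l(G). *)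

Set Implicit Arguments.
Unset Strict Implicit.
Unset Printing Implicit Defensive.

Import GroupScope.

(** * Classical preliminaries *)

(** Over a finite type, excluded middle at each point is enough to turn a
    predicate into a set, because finitely many choices can be made at once. *)
Lemma finset_of_Prop (T : finType) (P : T -> Prop) :
  exists A : {set T}, forall x, x \in A <-> P x.
Proof.
have dP x : exists b : bool, b <-> P x.
  by case: (classic (P x)) => Px; [exists true | exists false]; split.
have [f fP] := fin_all_exists dP.
by exists [set x | f x] => x; rewrite inE.
Qed.

Lemma bounded_has_maximum (P : nat -> Prop) n b :
  P n -> (forall m, P m -> m <= b) -> exists m, is_maximum P m.
Proof.
move=> Pn; elim: b => [|b IHb] leP.
  by exists n; split=> // m /leP; rewrite leqn0 => /eqP->.
case: (classic (P b.+1)) => [Pb | nPb]; first by exists b.+1.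
apply: IHb => m Pm; rewrite -ltnS ltn_neqAle leP // andbT.
by apply/eqP=> eq_m; case: nPb; rewrite -eq_m.
Qed.

(** * From irredundant sequences to chains of subgroups *)

(** A strictly decreasing sequence that stops above the trivial group becomes
    a chain when the trivial group is appended, so the bound needs no condition
    on the last term. *)
Lemma size_proper_path (gT : finGroupType) (G : {group gT})
    (t : seq {group gT}) :
  path (fun H K : {group gT} => K \proper H) G t ->
  size t <= subgroup_length G.
Proof.
move=> Gt; have [_ max_l] := subgroup_lengthP G.
have [t1 | nt1] := eqVneq (last G t) 1%G.
  by apply: max_l; exists t; rewrite // /subgroup_chain Gt t1 eqxx.
apply: leq_trans (leqnSn _) (max_l (size t).+1 _).
exists (rcons t 1%G); last by rewrite size_rcons.
by rewrite /subgroup_chain rcons_path last_rcons Gt eqxx proper1G nt1.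
Qed.

Section Representation.

Variables (gT : finGroupType) (G : {group gT}) (Omega : Type).
Variable to : action G Omega.

Lemma repM x : {in G &, act_morph to x}.
Proof. by case: (to) => ? []. Qed.

(** The point [to x 1] has the same image as [x] under 1, which acts
    injectively. *)
Lemma rep1 x : to x 1 = x.
Proof.
have inj_to : left_injective to by case: (to) => ? [].
by apply: (inj_to 1); rewrite -repM ?group1 ?mulg1.
Qed.

Lemma pointwise_stab_rcons s x g :
  pointwise_stab to (rcons s x) g <-> pointwise_stab to s g /\ to x g = x.
Proof.
rewrite /pointwise_stab -cats1; split=> [[Gg] | [[Gg sg] xg]].
  by move/(proj1 (Forall_app _ _ _))=> [sg xg]; split=> //; apply: Forall_inv xg.
by split=> //; apply: (proj2 (Forall_app _ _ _)); split=> //; constructor.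
Qed.

Lemma point_stab_group (H : {group gT}) x : H \subset G ->
  exists K : {group gT}, forall g, g \in K <-> g \in H /\ to x g = x.
Proof.
move=> /subsetP sHG.
have [A AP] := finset_of_Prop (fun g => g \in H /\ to x g = x).
have gA : group_set A.
  apply/group_setP; split=> [|a b /AP[Ha xa] /AP[Hb xb]]; apply/AP.
    by rewrite group1 rep1.
  by rewrite groupM // repM ?sHG // xa xb.
by exists (group gA).
Qed.

Lemma irredundant_nil : irredundant to [::].
Proof. by case. Qed.

Lemma irredundant_rcons s x :
  irredundant to (rcons s x) <->
  irredundant to s /\ exists2 g, pointwise_stab to s g & to x g <> x.
Proof.
split=> [irr | [irr [g sg xg]] s1 y s2].
  split=> [s1 y s2 def_s | ].
    by apply: (irr s1 y (rcons s2 x)); rewrite def_s rcons_cat.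
  apply: NNPP => fix_x; apply: (irr s x [::]); first by rewrite cats1.
  by move=> g sg; apply: NNPP => xg; apply: fix_x; exists g.
case/lastP: s2 => [|s2 z].
  by rewrite cats1 => /rcons_inj[<- <-] /(_ g sg).
by rewrite -rcons_cons -rcons_cat => /rcons_inj[/irr].
Qed.

(** Irredundancy says precisely that each new point makes the stabiliser
    strictly smaller.  Tracking the last stabiliser is what makes the induction
    go through. *)
Lemma irredundant_stab_path s : irredundant to s ->
  exists t : seq {group gT},
    [/\ path (fun H K : {group gT} => K \proper H) G t,
        size t = size s, last G t \subset G
      & forall g, g \in last G t <-> pointwise_stab to s g].
Proof.
elim/last_ind: s => [_ | s x IHs /irredundant_rcons[/IHs]].
  by exists [::]; split=> // g; rewrite /pointwise_stab; split=> [|[]].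
case=> t [Gt szt sHG HP] [g sg xg].
have [K KP] := point_stab_group x sHG.
have sKH : K \subset last G t by apply/subsetP=> h /KP[].
exists (rcons t K); split.
- rewrite rcons_path Gt properE sKH; apply/subsetPn; exists g; first exact/HP.
  by apply/negP=> /KP[].
- by rewrite !size_rcons szt.
- by rewrite last_rcons (subset_trans sKH).
- move=> h; rewrite last_rcons pointwise_stab_rcons.
  by split=> [/KP[/HP] | [/HP Hh xh]] //; apply/KP.
Qed.

Lemma size_irredundant s : irredundant to s -> size s <= subgroup_length G.
Proof.
by case/irredundant_stab_path=> t [Gt <- _ _]; apply: size_proper_path.
Qed.

Lemma irredundant_maximal_base s :
    irredundant to s ->
    (forall s', irredundant to s' -> size s' <= size s) ->
  is_base to s.
Proof.
move=> irr max_s g; split=> [sg | [Gg fix_g]]; last first.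
  by split=> //; apply: (proj2 (Forall_forall _ _)) => x _.
split=> [|x]; first by case: sg.
apply: NNPP => xg; have: irredundant to (rcons s x).
  by apply/irredundant_rcons; split=> //; exists g.
by move/max_s; rewrite size_rcons ltnn.
Qed.

(** The maximum is taken over all irredundant sequences, where it clearly
    exists; it is attained at a base, so it is the maximum over irredundant
    bases as well. *)
Lemma max_irredundant_base_size_le :
  exists2 m, is_max_irredundant_base_size to m & m <= subgroup_length G.
Proof.
pose P m := exists2 s, irredundant to s & size s = m.
have leP m : P m -> m <= subgroup_length G.
  by case=> s irr <-; apply: size_irredundant.
have P0 : P 0 by exists [::]; [apply: irredundant_nil |].
have [m [Pm max_m]] := bounded_has_maximum P0 leP.
exists m; last exact: leP.
split=> [|n [s [_ irr <-]]]; last by apply: max_m; exists s.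
have [s irr szs] := Pm; exists s; split=> //.
by apply: irredundant_maximal_base => // s' irr'; rewrite szs max_m //; exists s'.
Qed.

End Representation.

(** * From chains of subgroups to irredundant bases *)

Section RightMultiplication.

Variables (gT : finGroupType) (G : {group gT}).

(** Cosets of different subgroups are points of one and the same set of
    subsets, so no disjoint union of coset spaces has to be formed. *)
Definition subset_action : action G {set gT} := 'Rs \ subsetT G.

Lemma subset_action_fix (H : {group gT}) g :
  subset_action H g = H <-> g \in H.
Proof.
rewrite [subset_action H g]rcosetE; split=> [<- | ]; first exact: rcoset_refl.
exact: rcoset_id.
Qed.

(** Since the terms decrease, stabilising all of them amounts to lying in the
    last one. *)
Lemma pointwise_stab_chain (t : seq {group gT}) g :
  path (fun H K : {group gT} => K \proper H) G t ->
  pointwise_stab subset_action [seq gval H | H <- t] g <-> g \in last G t.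
Proof.
elim/last_ind: t => [_ | t K IHt].
  by rewrite /pointwise_stab; split=> [[]|].
rewrite rcons_path map_rcons last_rcons pointwise_stab_rcons.
case/andP=> /IHt-> /properP[/subsetP sKH _]; rewrite subset_action_fix.
by split=> [[]|Kg] //; split=> //; apply: sKH.
Qed.

Lemma irredundant_chain (t : seq {group gT}) :
  path (fun H K : {group gT} => K \proper H) G t ->
  irredundant subset_action [seq gval H | H <- t].
Proof.
elim/last_ind: t => [_ | t K IHt]; first exact: irredundant_nil.
rewrite rcons_path map_rcons => /andP[Gt /properP[_ [g Hg nKg]]].
apply/irredundant_rcons; split; first exact: IHt.
exists g; first exact/pointwise_stab_chain.
by move/subset_action_fix; apply/negP.
Qed.

Lemma subgroup_chain_base (t : seq {group gT}) :
  subgroup_chain G t -> is_base subset_action [seq gval H | H <- t].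
Proof.
case/andP=> Gt /eqP t1 g; rewrite pointwise_stab_chain // t1.
split=> [/set1P-> | [_ fix_g]].
  by split=> [|A]; [apply: group1 | apply: act1].
exact/(subset_action_fix 1%G).
Qed.

End RightMultiplication.

Theorem proposition2p2 (gT : finGroupType) (G : {group gT}) :
  is_b1 G (subgroup_length G).
Proof.
split=> [Omega to | ]; first exact: max_irredundant_base_size_le.
exists {set gT}, (subset_action G).
split=> [|n [s [_ irr <-]]]; last exact: size_irredundant irr.
have [[t chain_t <-] _] := subgroup_lengthP G.
exists [seq gval H | H <- t]; split; last exact: size_map.
  exact: subgroup_chain_base.
by apply: irredundant_chain; case/andP: chain_t.
Qed.
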